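(* There exist constants $c>0$, $k_0$, and $\varepsilon>0$ such that for all integers $k\geq k_0$ and all integers $n$ with $c\log k\leq n\leq k/4$, \[ R_k(k+n;2^{-\varepsilon n})\geq \mathrm{tw}_{\lfloor k/n\rfloor}(2). \]
   Context: For a positive integer $N$, $[N]=\{1,2,\dots,N\}$, and $\binom{S}{k}$ denotes the set of all $k$-element subsets of a set $S$. For integers $k<m$ and a real $0<\delta\leq 1$, $R_k(m;\delta)$ denotes the smallest $N$ such that for every coloring of $\binom{[N]}{k}$ by two colors there is an $m$-element set $M\subseteq[N]$ for which one color class contains at least $\left(\frac{1+\delta}{2}\right)\binom{m}{k}$ of the elements of $\binom{M}{k}$. The tower function is defined by $\mathrm{tw}_1(x)=x$ and $\mathrm{tw}_{j+1}(x)=2^{\mathrm{tw}_j(x)}$. *)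

(* Defs.v *)
From HB Require Import structures.
From mathcomp Require Import all_boot all_order all_algebra.
From mathcomp Require Import boolp reals exp.

Set Implicit Arguments.
Unset Strict Implicit.
Unset Printing Implicit Defensive.

Import Order.TTheory GRing.Theory Num.Theory.

Local Open Scope ring_scope.

(* [tw j] is only meaningful for [1 <= j]; [tw 0] is a junk value. *)
Definition tw (j x : nat) : nat := iter j.-1 (expn 2) x.

Lemma tw1 x : tw 1 x = x.
Proof. by []. Qed.

Lemma twS j x : (0 < j)%N -> tw j.+1 x = (2 ^ tw j x)%N.
Proof. by case: j. Qed.

Definition ksubsets (T : finType) (S : {set T}) (k : nat) : {set {set T}} :=
  [set e : {set T} | e \subset S & #|e| == k].

(* The ground set [N] is represented by 'I_N.  A coloring is defined on all
   subsets of 'I_N, but only its values on the k-element ones matter. *)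
Definition almost_mono (R : realType) (k m : nat) (delta : R) (N : nat) : bool :=
  [forall c : {ffun {set 'I_N} -> bool},
    [exists M : {set 'I_N}, (#|M| == m) &&
      [exists b : bool,
        (1 + delta) / 2 * 'C(m, k)%:R
          <= #|[set e in ksubsets M k | c e == b]|%:R]]].

(* The default value 0 is never used when [delta <= 1], by [almost_mono_ex]
   below. *)
Definition ramsey_almost (R : realType) (k m : nat) (delta : R) : nat :=
  if pselect (exists N, almost_mono k m delta N) is left exN
  then ex_minn exN else 0%N.

Lemma hypergraph_ramsey (k p q : nat) : exists N : nat,
  forall (T : finType) (A : {set T}) (c : {set T} -> bool), (N <= #|A|)%N ->
  exists2 M : {set T}, M \subset A &
    (#|M| = p /\ {in ksubsets M k, forall e, c e = true}) \/
    (#|M| = q /\ {in ksubsets M k, forall e, c e = false}).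
Proof.
have sub_card (T : finType) (A : {set T}) n : (n <= #|A|)%N ->
    exists2 M : {set T}, M \subset A & #|M| = n.
  move=> nA; have: (0 < #|[set B : {set T} | B \subset A & #|B| == n]|)%N.
    by rewrite cards_draws bin_gt0.
  by case/card_gt0P=> M; rewrite inE => /andP[MA /eqP Mn]; exists M.
elim: k p q => [|k IHk] p q.
  exists (maxn p q) => T A c; rewrite geq_max => /andP[pA qA].
  have c0 (M e : {set T}) : e \in ksubsets M 0 -> c e = c set0.
    by rewrite inE => /andP[_]; rewrite cards_eq0 => /eqP ->.
  case c0E: (c set0).
    have [M MA Mp] := sub_card T A p pA; exists M => //; left; split=> // e /c0.
    by rewrite c0E.
  have [M MA Mq] := sub_card T A q qA; exists M => //; right; split=> // e /c0.
  by rewrite c0E.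
have no_edge (T : finType) (e : {set T}) : e \in ksubsets set0 k.+1 -> False.
  by rewrite inE subset0 => /andP[/eqP ->]; rewrite cards0.
have extend (T : finType) (x : T) (M M' : {set T}) (c : {set T} -> bool) b :
    M' \subset M ->
    {in ksubsets M k, forall e, c (x |: e) = b} ->
    {in ksubsets M' k.+1, forall e, c e = b} ->
    {in ksubsets (x |: M') k.+1, forall e, c e = b}.
  move=> M'M cM cM' e; rewrite inE => /andP[eM /eqP ek].
  have [xe|xNe] := boolP (x \in e).
    rewrite -(setD1K xe); apply: cM; rewrite inE; apply/andP; split.
      by apply: subset_trans M'M; rewrite subDset.
    by have := cardsD1 x e; rewrite xe ek => -[->].
  apply: cM'; rewrite inE ek eqxx andbT; apply/subsetP=> y ye.
  have := subsetP eM y ye; rewrite !inE => /orP[/eqP yx|//].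
  by rewrite -yx ye in xNe.
elim: p q => [|p IHp] q.
  exists 0%N => T A c _; exists set0; first exact: sub0set.
  by left; rewrite cards0; split=> // e /no_edge.
elim: q => [|q [Nq IHq]].
  exists 0%N => T A c _; exists set0; first exact: sub0set.
  by right; rewrite cards0; split=> // e /no_edge.
have [Np {}IHp] := IHp q.+1; have [N {}IHk] := IHk Np Nq.
exists N.+1 => T A c NA.
have /card_gt0P[x xA] : (0 < #|A|)%N by apply: leq_trans NA.
have NAx : (N <= #|A :\ x|)%N by move: NA; rewrite (cardsD1 x) xA.
have addx (M : {set T}) : M \subset A :\ x ->
    x |: M \subset A /\ #|x |: M| = #|M|.+1.
  move=> MA; split.
    by rewrite subUset sub1set xA (subset_trans MA) ?subD1set.
  rewrite cardsU1; case: (boolP (x \in M)) => // xM.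
  by have := subsetP MA x xM; rewrite !inE eqxx.
have [M MA [[MN cM]|[MN cM]]] := IHk T (A :\ x) (fun e => c (x |: e)) NAx.
  have [|M' M'M [[M'p cM']|cM']] := IHp T M c; first by rewrite MN.
    have [M'A M'c] := addx M' (subset_trans M'M MA).
    by exists (x |: M') => //; left; rewrite M'c M'p; split=> //; apply: extend cM cM'.
  exists M'; last by right.
  by rewrite (subset_trans M'M) // (subset_trans MA) ?subD1set.
have [|M' M'M [cM'|[M'q cM']]] := IHq T M c; first by rewrite MN.
  exists M'; last by left.
  by rewrite (subset_trans M'M) // (subset_trans MA) ?subD1set.
have [M'A M'c] := addx M' (subset_trans M'M MA).
by exists (x |: M') => //; right; rewrite M'c M'q; split=> //; apply: extend cM cM'.
Qed.

Lemma almost_mono_ex (R : realType) (k m : nat) (delta : R) :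
  delta <= 1 -> exists N, almost_mono k m delta N.
Proof.
move=> d1; have [N NP] := hypergraph_ramsey k m m; exists N.
apply/forallP => c; have [|M _ cM] := NP 'I_N setT c; first by rewrite cardsT card_ord.
have [b [Mm {}cM]] : exists b, #|M| = m /\ {in ksubsets M k, forall e, c e = b}.
  by case: cM => ?; [exists true|exists false].
apply/existsP; exists M; rewrite Mm eqxx; apply/existsP; exists b.
have -> : [set e in ksubsets M k | c e == b] = ksubsets M k.
  apply/setP=> e; rewrite inE; case: (boolP (e \in _)) => //= eM.
  by rewrite cM ?eqxx.
rewrite cards_draws Mm ler_piMl // ler_pdivrMr // mul1r.
by rewrite -[2]/(1 + 1) lerD2l.
Qed.

Lemma ramsey_almostP (R : realType) (k m : nat) (delta : R) : delta <= 1 ->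
  almost_mono k m delta (ramsey_almost k m delta) /\
  forall N, almost_mono k m delta N -> (ramsey_almost k m delta <= N)%N.
Proof.
move=> /(almost_mono_ex k m) exN; rewrite /ramsey_almost.
by case: pselect => // ?; case: ex_minnP.
Qed.

(* Main.v *)
Require Import Defs.
From HB Require Import structures.
From mathcomp Require Import all_boot all_order all_algebra.
From mathcomp Require Import boolp reals sequences exp.
From mathcomp Require Import zify ring lra.

(* Write d(x,y) for the highest binary position where x and y differ.  Replacing a
   sequence a_1 < ... < a_l below tw_t(2) by the sequence of the d(a_i,a_(i+1)) lowers
   the tower by one storey, and consecutive terms of the new sequence differ.  The
   pattern of a finite set records all comparisons of consecutive terms in the first t
   iterates of this operation on its increasing enumeration.  If the patterns of
   (a_1..a_l) and (a_2..a_(l+1)) agree then all iterates are monotone, so that l <= t.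

   Now let M have k + n points, of which n are deleted.  Fix every second deleted point;
   the remaining n/2 each move in the gap between two fixed ones, and by the above those
   positions of such a point that yield one given pattern of the remaining k-set span at
   most t + 1 places.  For t <= k/n this leaves an exponentially small proportion of the
   n-subsets, that is, no pattern occurs with frequency more than 2^(-c n).  A random
   function of the pattern is therefore balanced on M up to 2^(-eps n), except with doubly
   exponentially small probability.  As d(x,z) = max(d(x,y),d(y,z)) for x < y < z, the
   iterated differences of the points of M are controlled by poly(k) bits, and a union
   bound over these bits replaces the one over all M. *)

Set Implicit Arguments.
Unset Strict Implicit.
Unset Printing Implicit Defensive.

Import Order.TTheory GRing.Theory Num.Theory.

Local Open Scope ring_scope.

(** * Iterated highest differing bits *)

Section Patterns.
Local Open Scope nat_scope.

Lemma top_bit_ex x y : exists j, x %/ 2 ^ j.+1 == y %/ 2 ^ j.+1.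
Proof.
exists (x + y); have lt2 z : z <= x + y -> z < 2 ^ (x + y).+1.
  by move=> zle; apply: leq_trans (ltn_expl _ (ltnSn 1)); rewrite ltnS ltnW.
by rewrite !divn_small ?lt2 ?leq_addr ?leq_addl.
Qed.

(* The highest binary position where x and y differ (and 0 if x = y). *)
Definition top_bit x y : nat := ex_minn (top_bit_ex x y).

Lemma leq_top_bit x y j : (top_bit x y <= j) = (x %/ 2 ^ j.+1 == y %/ 2 ^ j.+1).
Proof.
rewrite /top_bit; case: ex_minnP => d /eqP xyd dmin; apply/idP/idP => [dj|]; last exact: dmin.
by rewrite -(subnKC dj) -addSn expnD !divnMA xyd.
Qed.

Lemma top_bitC x y : top_bit x y = top_bit y x.
Proof. by apply/eqP; rewrite eqn_leq !leq_top_bit eq_sym -leq_top_bit leqnn eq_sym -leq_top_bit leqnn. Qed.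

Lemma top_bitxx x : top_bit x x = 0.
Proof. by apply/eqP; rewrite -leqn0 leq_top_bit. Qed.

Lemma ltn_top_bit x y n : 0 < n -> x < 2 ^ n -> y < 2 ^ n -> top_bit x y < n.
Proof. by case: n => // n _ xn yn; rewrite ltnS leq_top_bit !divn_small. Qed.

Lemma top_bit_trans x y z : x <= y <= z ->
  top_bit x z = maxn (top_bit x y) (top_bit y z).
Proof.
case/andP=> xy yz; have key j : (top_bit x z <= j) = (maxn (top_bit x y) (top_bit y z) <= j).
  rewrite geq_max !leq_top_bit; set q := 2 ^ j.+1.
  have := leq_div2r q xy; have := leq_div2r q yz.
  by move: (x %/ q) (y %/ q) (z %/ q) => a b c; lia.
by apply/eqP; rewrite eqn_leq key leqnn -key leqnn.
Qed.

Lemma top_bit_div x y : x < y -> x %/ 2 ^ top_bit x y < y %/ 2 ^ top_bit x y.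
Proof.
move=> xy; rewrite ltn_neqAle leq_div2r ?(ltnW xy) // andbT.
case E: (top_bit x y) => [|d]; first by rewrite !divn1 ltn_eqF.
by rewrite -leq_top_bit E -ltnNge.
Qed.

(** If both differences sat at the same bit [d], the quotients by [2 ^ d] would be three increasing
    numbers with the same half, but only two numbers share a half. *)
Lemma top_bit_neq x y z : x < y < z -> top_bit x y != top_bit y z.
Proof.
case/andP=> xy yz; apply/eqP => E.
have := top_bit_div xy; have := top_bit_div yz; rewrite -E.
have: top_bit x y <= top_bit x y by []; rewrite leq_top_bit => /eqP.
have: top_bit y z <= top_bit y z by []; rewrite leq_top_bit -E => /eqP.
rewrite expnSr !divnMA; set q := 2 ^ _; move: (x %/ q) (y %/ q) (z %/ q) => a b c.
lia.
Qed.

Definition step (a : nat -> nat) (i : nat) : nat := top_bit (a i) (a i.+1).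

Definition ascent (a : nat -> nat) (j i : nat) : bool :=
  iter j step a i < iter j step a i.+1.

Lemma iter_step_local j a b p q : (forall l, l <= j -> a (p + l) = b (q + l)) ->
  iter j step a p = iter j step b q.
Proof.
elim: j p q => [|j IHj] p q ab; first by have := ab 0 (leqnn _); rewrite !addn0.
rewrite !iterS /step (IHj p q) ?(IHj p.+1 q.+1) // => l lj; last by rewrite ab // leqW.
by rewrite !addSnnS ab.
Qed.

Lemma ascent_local j a b p q : (forall l, l <= j.+1 -> a (p + l) = b (q + l)) ->
  ascent a j p = ascent b j q.
Proof.
move=> ab; rewrite /ascent (@iter_step_local j a b p q).
  by rewrite (@iter_step_local j a b p.+1 q.+1) // => l lj; rewrite !addSnnS ab.
by move=> l lj; rewrite ab // leqW.
Qed.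

(** Induction on [t]: the terms of [step a] lie one storey lower, neighbors among them differ by
    [top_bit_neq], and the agreement of their comparisons makes them monotone. At [t = 0] the values
    are below 2, which leaves room for two terms only. *)
Lemma steady_length t p l (a : nat -> nat) :
  (forall i, p <= i <= p + l -> a i < tw t.+1 2) ->
  (forall i, p <= i < p + l -> a i < a i.+1) \/
  (forall i, p <= i < p + l -> a i.+1 < a i) ->
  (forall j i, j <= t -> p <= i -> i + j + 2 <= p + l ->
     ascent a j i = ascent a j i.+1) ->
  l <= t.+1.
Proof.
elim: t l a => [|t IHt] l a aN mono steady.
  case: leqP => // l2; rewrite /tw /= in aN.
  have := aN p; have := aN p.+2.
  by case: mono => mono; have := mono p; have := mono p.+1; lia.
case: l => // l in aN mono steady *; rewrite ltnS; apply: (IHt l (step a)).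
- move=> i pi; rewrite /step; apply: ltn_top_bit.
  + by rewrite /tw /=; case: (t) => //= *; rewrite expn_gt0.
  + by have := aN i; rewrite twS //; apply; lia.
  + by have := aN i.+1; rewrite twS //; apply; lia.
- have neq i : p <= i < p + l -> step a i != step a i.+1.
    move=> pi; rewrite /step; case: mono => mono.
      by apply: top_bit_neq; rewrite !mono //; lia.
    by rewrite eq_sym (top_bitC (a i)) (top_bitC (a i.+1)); apply: top_bit_neq; rewrite !mono //; lia.
  (* All comparisons at level 1 agree with the first one, so [step a] is strictly monotone on the
     window. *)
  have const i : p <= i < p + l -> ascent a 1 i = ascent a 1 p.
    elim: i => [|i IHi] pi; first by congr ascent; lia.
    have [->//|ip] := eqVneq i.+1 p.
    have <- : ascent a 1 i = ascent a 1 p by apply: IHi; lia.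
    by symmetry; apply: steady; lia.
  rewrite /ascent /= in const.
  case E: (step a p < step a p.+1); [left|right] => i pi; have := const i pi; rewrite E.
    by [].
  by move=> /negbT; rewrite -leqNgt leq_eqVlt eq_sym (negPf (neq i pi)).
- move=> j i jt pi ip; have := steady j.+1 i; rewrite /ascent !iterSr; apply; lia.
Qed.

End Patterns.

(** * Deleting points from a finite set *)

Section Deletions.
Local Open Scope nat_scope.

Lemma nth_filter_iota_lt (P : pred nat) m x r : x <= m ->
  r < count P (iota 0 x) -> nth m (filter P (iota 0 m)) r < x.
Proof.
move=> xm rx; rewrite -{2}(subnKC xm) iotaD filter_cat nth_cat size_filter rx.
have : nth m (filter P (iota 0 x)) r \in filter P (iota 0 x) by rewrite mem_nth ?size_filter.
by rewrite mem_filter mem_iota => /and3P[].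
Qed.

(** The default [m] of [nth] covers the ranks beyond the last element. *)
Lemma nth_filter_iota_ge (P : pred nat) m x r : x <= m ->
  count P (iota 0 x) <= r -> x <= nth m (filter P (iota 0 m)) r.
Proof.
move=> xm rx; rewrite -{2}(subnKC xm) iotaD filter_cat nth_cat size_filter ltnNge rx /=.
set s := filter _ _; set q := r - _.
have [qs|sq] := ltnP q (size s); last by rewrite nth_default.
by have := mem_nth m qs; rewrite mem_filter mem_iota => /and3P[].
Qed.

Lemma nth_filter_iota_count (P : pred nat) m x : x < m -> P x ->
  nth m (filter P (iota 0 m)) (count P (iota 0 x)) = x.
Proof.
move=> xm Px; rewrite -{2}(subnKC (ltnW xm)) iotaD filter_cat nth_cat size_filter ltnn subnn.
by rewrite add0n -(subnSK xm) /= Px.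
Qed.

Lemma count_filter_iota (P : pred nat) m x r : x <= m ->
  (0 < r -> nth m (filter P (iota 0 m)) r.-1 < x) ->
  x <= nth m (filter P (iota 0 m)) r -> count P (iota 0 x) = r.
Proof.
move=> xm lo hi; apply/eqP; rewrite eqn_leq; apply/andP; split.
  by rewrite leqNgt; apply/negP => /(nth_filter_iota_lt xm); rewrite ltnNge hi.
case: r lo hi => // r lo hi; rewrite ltnNge; apply/negP => /(nth_filter_iota_ge xm).
by rewrite leqNgt lo.
Qed.

(** Exactly [r] numbers below [x] satisfy [P], and [x] does not, so [x - r] numbers of the
    complement precede [x]. *)
Lemma nth_filter_predC (P : pred nat) m x r : x < m -> r <= x ->
  (0 < r -> nth m (filter P (iota 0 m)) r.-1 < x) ->
  x < nth m (filter P (iota 0 m)) r ->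
  nth m (filter (predC P) (iota 0 m)) (x - r) = x.
Proof.
move=> xm rx lo hi; have cr := count_filter_iota (ltnW xm) lo (ltnW hi).
have NPx : ~~ P x.
  by apply/negP=> /(nth_filter_iota_count xm); rewrite cr => E; rewrite E ltnn in hi.
have -> : x - r = count (predC P) (iota 0 x).
  by have := count_predC P (iota 0 x); rewrite cr size_iota; lia.
exact: nth_filter_iota_count.
Qed.

Definition ord_vals N (e : {set 'I_N}) : seq nat := [seq val x | x <- enum e].

(** The default [N] acts as a sentinel above all elements, so the gap after the last element is
    treated like any other. *)
Definition elems N (e : {set 'I_N}) (i : nat) : nat := nth N (ord_vals e) i.

Lemma ord_vals_sorted N (e : {set 'I_N}) : sorted ltn (ord_vals e).
Proof.
rewrite sorted_map /enum_mem; apply: sorted_filter => [y x z|]; first exact: ltn_trans.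
by rewrite -enumT -sorted_map val_enum_ord iota_ltn_sorted.
Qed.

Lemma mem_ord_vals N (e : {set 'I_N}) (x : 'I_N) : (val x \in ord_vals e) = (x \in e).
Proof. by rewrite (mem_map val_inj) mem_enum. Qed.

Lemma ord_vals_lt N (e : {set 'I_N}) x : x \in ord_vals e -> x < N.
Proof. by case/mapP => y _ ->; apply: ltn_ord. Qed.

Lemma size_ord_vals N (e : {set 'I_N}) : size (ord_vals e) = #|e|.
Proof. by rewrite size_map -cardE. Qed.

Lemma ord_valsE N (e : {set 'I_N}) (P : pred nat) :
  (forall x : 'I_N, P x = (x \in e)) -> ord_vals e = filter P (iota 0 N).
Proof.
move=> Pe; apply: (@irr_sorted_eq _ ltn) => [||||x].
- exact: ltn_trans.
- exact: ltnn.
- exact: ord_vals_sorted.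
- by apply: sorted_filter; [apply: ltn_trans|apply: iota_ltn_sorted].
rewrite mem_filter mem_iota add0n leq0n /=; case: (ltnP x N) => [xN|].
  by rewrite -[x]/(val (Ordinal xN)) mem_ord_vals Pe andbT.
by rewrite andbF leqNgt => /negP xN; apply/negP => /ord_vals_lt.
Qed.

Lemma ord_vals_inj N : injective (@ord_vals N).
Proof. by move=> e e' ee; apply/setP => x; rewrite -!mem_ord_vals ee. Qed.

Lemma elems_lt N (e : {set 'I_N}) i : i < #|e| -> elems e i < N.
Proof. by move=> ie; apply: (@ord_vals_lt _ e); rewrite mem_nth ?size_ord_vals. Qed.

Lemma elems_mono N (e : {set 'I_N}) i j : i < j -> j < #|e| -> elems e i < elems e j.
Proof.
move=> ij je; apply: (sorted_ltn_nth ltn_trans) => //; first exact: ord_vals_sorted.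
  by rewrite inE size_ord_vals (ltn_trans ij).
by rewrite inE size_ord_vals.
Qed.

Lemma elems_setC N (D : {set 'I_N}) x r : x < N -> r <= x ->
  (0 < r -> elems D r.-1 < x) -> x < elems D r -> elems (~: D) (x - r) = x.
Proof.
set P := fun i => i \in ord_vals D.
have DE : ord_vals D = filter P (iota 0 N) by apply: ord_valsE => y; apply: mem_ord_vals.
have DCE : ord_vals (~: D) = filter (predC P) (iota 0 N).
  by apply: ord_valsE => y; rewrite !inE /P /= mem_ord_vals.
by rewrite /elems DE DCE; apply: nth_filter_predC.
Qed.

Lemma leq_elems N (D : {set 'I_N}) i : i < #|D| -> i <= elems D i.
Proof.
elim: i => // i IHi iD; apply: leq_ltn_trans (IHi (ltnW iD)) _.
exact: elems_mono.
Qed.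

(* D' is obtained from D by moving its i-th point from p to p + l inside a gap
   of D, so that the complements of D and D' carry at the same ranks the
   windows [p + 1, p + l] and [p, p + l - 1]. *)
Lemma elems_setC_move m (D D' : {set 'I_m}) i l x : i < #|D| -> i < #|D'| ->
  (0 < i -> elems D i.-1 = elems D' i.-1) -> elems D i.+1 = elems D' i.+1 ->
  elems D' i = elems D i + l -> elems D i <= x < elems D i + l ->
  elems (~: D) (x - i) = x.+1 /\ elems (~: D') (x - i) = x.
Proof.
move=> iD iD' lo hi mv /andP[px xl].
have pm : elems D i + l < m by rewrite -mv elems_lt.
have ip := leq_elems iD.
split.
  rewrite -subSS; apply: elems_setC; [lia|lia|by rewrite /= ltnS|].
  rewrite hi; apply: leq_ltn_trans xl _; rewrite -mv.
  have [iD'1|iD'1] := ltnP i.+1 #|D'|; first exact: elems_mono.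
  by rewrite {2}/elems nth_default ?size_ord_vals // mv.
apply: elems_setC; [lia|lia| |by rewrite mv].
move=> i0; rewrite -lo //; apply: leq_trans px; apply: elems_mono => //; lia.
Qed.

(** [ascent a j i] reads the terms [i] to [i + j + 1] of [a]; the guard restricts it to the first
    [k] terms. *)
Definition pattern t k (a : nat -> nat) : {ffun 'I_t * 'I_k -> bool} :=
  [ffun q : 'I_t * 'I_k => (q.2 + q.1 + 1 < k) && ascent a q.1 q.2].

Lemma pattern_ascent t k a b j i : pattern t k a = pattern t k b ->
  j < t -> i + j + 1 < k -> ascent a j i = ascent b j i.
Proof.
move=> ab jt ik; have ik' : i < k by lia.
have /ffunP/(_ (Ordinal jt, Ordinal ik')) := ab.
by rewrite !ffunE /= ik.
Qed.

Lemma eq_pattern t k a b : (forall i, i < k -> a i = b i) -> pattern t k a = pattern t k b.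
Proof.
move=> ab; apply/ffunP => -[[j jt] [i ik]]; rewrite !ffunE /=.
case: (ltnP (i + j + 1) k) => //= ijk; apply: ascent_local => l lj; apply: ab; lia.
Qed.

(** For [x] in the range of the move, rank [x - i] holds [x + 1] in the complement of [D] and [x] in
    that of [D']. Equal patterns thus make the comparisons of the iterates of [mu] at [x] and
    [x + 1] agree, and [steady_length] bounds the range. *)
Lemma same_pattern_move_leq t m k (mu : nat -> nat) (D D' : {set 'I_m}) i l :
  (forall x, x < m -> mu x < tw t.+1 2) ->
  (forall x y, x < y -> y < m -> mu x < mu y) ->
  #|~: D| = k ->
  pattern t.+1 k (mu \o elems (~: D)) = pattern t.+1 k (mu \o elems (~: D')) ->
  i < #|D| -> i < #|D'| ->
  (0 < i -> elems D i.-1 = elems D' i.-1) -> elems D i.+1 = elems D' i.+1 ->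
  elems D' i = elems D i + l -> l <= t.+1.
Proof.
move=> mutw mumono Dk pat iD iD' lo hi mv; set p := elems D i in mv *.
have pm : p + l < m by rewrite -mv elems_lt.
have ip : i <= p := leq_elems iD.
have win x : p <= x < p + l -> elems (~: D) (x - i) = x.+1 /\ elems (~: D') (x - i) = x.
  exact: elems_setC_move.
apply: (@steady_length t p l mu).
- by move=> x xp; apply: mutw; lia.
- by left=> x xp; apply: mumono; lia.
move=> j x jt px xl.
have -> : ascent mu j x = ascent (mu \o elems (~: D')) j (x - i).
  apply: ascent_local => q qj /=; congr mu.
  have -> : x - i + q = x + q - i by lia.
  by have [|_ ->] := win (x + q); lia.
have -> : ascent mu j x.+1 = ascent (mu \o elems (~: D)) j (x - i).
  apply: ascent_local => q qj /=; congr mu.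
  have -> : x - i + q = x + q - i by lia.
  by have [|-> _] := win (x + q); lia.
symmetry; apply: pattern_ascent pat _ _ => //.
(* The guard in [pattern] requires this rank to be below [k]. It is, since the entry there is
   [x + j + 2 < m], whereas a rank out of range would give [m]. *)
have [|E _] := win (x + j + 1); first lia.
rewrite -Dk ltnNge; apply/negP => kle.
suff : elems (~: D) (x + j + 1 - i) = m by lia.
by rewrite /elems nth_default ?size_ord_vals; lia.
Qed.

End Deletions.

(** * Counting the k-subsets with a given pattern *)

Section Atoms.
Local Open Scope nat_scope.

Definition even_part m (n : nat) (D : {set 'I_m}) : {set 'I_m} :=
  [set x | val x \in [seq elems D i.*2 | i <- iota 0 (n - n./2)]].

Lemma ord_vals_even_part m n (D : {set 'I_m}) : #|D| = n ->
  ord_vals (even_part n D) = [seq elems D i.*2 | i <- iota 0 (n - n./2)].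
Proof.
move=> Dn; apply: (@irr_sorted_eq _ ltn) => [||||x].
- exact: ltn_trans.
- exact: ltnn.
- exact: ord_vals_sorted.
- apply/(sortedP 0) => i; rewrite size_map size_iota => i1.
  rewrite !(nth_map 0) ?size_iota ?nth_iota //; try lia.
  by apply: elems_mono; rewrite ?Dn; lia.
case: (ltnP x m) => [xm|mx].
  by rewrite -[x]/(val (Ordinal xm)) mem_ord_vals inE.
apply/idP/idP => [/ord_vals_lt|]; first by rewrite ltnNge mx.
case/mapP => i; rewrite mem_iota => ih xE; suff : x < m by rewrite ltnNge mx.
by rewrite xE elems_lt // Dn; lia.
Qed.

(* The odd-indexed points of the deleted set are pinned down by the others up to
   t + 1 choices each, hence by their residues modulo t + 1. *)
Lemma card_pattern_fiber t m k n (mu : nat -> nat) (s : {ffun 'I_t.+1 * 'I_k -> bool}) :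
  m = k + n ->
  (forall x, x < m -> mu x < tw t.+1 2) ->
  (forall x y, x < y -> y < m -> mu x < mu y) ->
  #|[set E : {set 'I_m} | (#|E| == k) && (pattern t.+1 k (mu \o elems E) == s)]|
    <= 'C(m, n - n./2) * t.+2 ^ n./2.
Proof.
move=> mE mutw mumono; set F := [set _ | _].
pose g (E : {set 'I_m}) : {set 'I_m} * {ffun 'I_n./2 -> 'I_t.+2} :=
  (even_part n (~: E), [ffun i : 'I_n./2 => inord (elems (~: E) i.*2.+1 %% t.+2)]).
have FC E : E \in F -> #|~: E| = n.
  by rewrite inE => /andP[/eqP Ek _]; have := cardsC E; rewrite Ek card_ord; lia.
have g_inj : {in F &, injective g}.
  move=> E E' EF EF' [ev od]; apply: setC_inj; apply: ord_vals_inj.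
  have Dn := FC _ EF; have Dn' := FC _ EF'.
  have evi i : elems (~: E) i.*2 = elems (~: E') i.*2.
    have [ih|ih] := ltnP i (n - n./2).
      have := congr1 (fun A => nth 0 (ord_vals A) i) ev.
      by rewrite /= !ord_vals_even_part // !(nth_map 0) ?size_iota ?nth_iota.
    by rewrite /elems !nth_default ?size_ord_vals ?Dn ?Dn' //; lia.
  apply: (@eq_from_nth _ m); first by rewrite !size_ord_vals Dn Dn'.
  move=> i; rewrite size_ord_vals Dn -/(elems (~: E) i) -/(elems (~: E') i) => i_n.
  have iE := odd_double_half i; case: (odd i) iE => /= iE; last by rewrite -iE evi.
  have od_i : elems (~: E) i = elems (~: E') i %[mod t.+2].
    have ih : i./2 < n./2 by lia.
    move/ffunP/(_ (Ordinal ih)): od; rewrite !ffunE /= => /(congr1 val) /=.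
    by rewrite !inordK ?ltn_mod // (_ : i./2.*2.+1 = i) //; lia.
  have lo : i.-1 = i./2.*2 by lia.
  have hi : i.+1 = i./2.+1.*2 by lia.
  have close (A A' : {set 'I_m}) : A \in F -> A' \in F ->
      (forall q, elems (~: A) q.*2 = elems (~: A') q.*2) ->
      elems (~: A) i <= elems (~: A') i -> elems (~: A') i - elems (~: A) i <= t.+1.
    move=> AF AF' AA' le; apply: (@same_pattern_move_leq t m k mu (~: A) (~: A') i).
    - by [].
    - by [].
    - by move: AF; rewrite setCK inE => /andP[/eqP].
    - by move: AF AF'; rewrite !setCK !inE => /andP[_ /eqP->] /andP[_ /eqP->].
    - by rewrite FC.
    - by rewrite FC.
    - by rewrite lo AA'.
    - by rewrite hi AA'.
    - by rewrite subnKC.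
  move: od_i (close E E' EF EF' evi) (close E' E EF' EF (fun q => esym (evi q))).
  move: (elems (~: E) i) (elems (~: E') i) => a b /eqP ab ca cb.
  (* The two positions are congruent modulo [t.+2] and at most [t.+1] apart, so they coincide. *)
  have [le|/ltnW le] := leqP a b.
    move: ab; rewrite eq_sym eqn_mod_dvd // => /dvdn_leq; have := ca le; lia.
  by move: ab; rewrite eqn_mod_dvd // => /dvdn_leq; have := cb le; lia.
rewrite -(card_in_imset g_inj).
have -> : 'C(m, n - n./2) * t.+2 ^ n./2 =
    #|setX [set O : {set 'I_m} | #|O| == n - n./2] [set: {ffun 'I_n./2 -> 'I_t.+2}]|.
  by rewrite cardsX cardsT card_ffun !card_ord card_draws card_ord.
apply/subset_leq_card/subsetP => _ /imsetP[E EF ->].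
by rewrite !inE andbT /= -size_ord_vals ord_vals_even_part ?FC // size_map size_iota.
Qed.

(** After squaring, pair the factor [n - i] with [n - (h - 1 - i)]. Each pair has sum
    [2 * n - h + 1], and AM-GM applies to it. *)
Lemma ffact_AMGM n h : h <= n -> n ^_ h * 2 ^ h <= (2 * n - h + 1) ^ h.
Proof.
move=> hn; rewrite -leq_sqr -!mulnn mulnACA -!expnMn.
have -> : n ^_ h * n ^_ h = \prod_(i < h) ((n - i) * (n - (h - i.+1))).
  rewrite big_split /= -ffact_prod; congr (_ * _).
  by rewrite ffact_prod (reindex_inj rev_ord_inj).
have prodc c : c ^ h = \prod_(i < h) c by rewrite prod_nat_const card_ord.
rewrite !prodc -big_split /=; apply: leq_prod => i _.
have := ltn_ord i; move: (nat_of_ord i) => {}i ih.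
pose b := n - h; pose c := h - i.+1.
have -> : n = i + c + 1 + b by rewrite /b /c; lia.
have -> : h = i + c + 1 by rewrite /c; lia.
have -> : i + c + 1 + b - i = c + 1 + b by lia.
have -> : i + c + 1 - i.+1 = c by lia.
have -> : i + c + 1 + b - c = i + 1 + b by lia.
have -> : 2 * (i + c + 1 + b) - (i + c + 1) + 1 = (c + 1 + b) + (i + 1 + b) by lia.
move: (c + 1 + b) (i + 1 + b) => x y; have [le4 _] := nat_AGM2 x y.
by rewrite mulnC mulnn.
Qed.

(** Multiplied by [(n - h)! * k!], both sides become [(k + n)!]. *)
Lemma bin_ffact_exchange k n h : h <= n ->
  'C(k + n, n - h) * (k + h) ^_ h = 'C(k + n, n) * n ^_ h.
Proof.
move=> hn.
have e1 := @bin_fact (k + n) (n - h) ltac:(lia).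
have e2 := @bin_fact (k + n) n ltac:(lia).
have e3 := @ffact_fact n h hn.
have e4 := @ffact_fact (k + h) h ltac:(lia).
have kh : k + n - (n - h) = k + h by lia.
have kn : k + n - n = k by lia.
have khh : k + h - h = k by lia.
rewrite kh in e1; rewrite kn in e2; rewrite khh in e4.
apply/eqP; rewrite -(@eqn_pmul2r ((n - h)`! * k`!)) ?muln_gt0 ?fact_gt0 //; apply/eqP.
transitivity ((k + n)`!); last rewrite -e2 -e3; [rewrite -e1 -e4|]; ring.
Qed.

End Atoms.

(** * Few bits determine the patterns of all subsets *)

Section Skeletons.
Local Open Scope nat_scope.

(* All highest differing bits of pairs of elements of the sorted sequence V already
   occur for neighbors, so that iterating gap_bits does not increase the size. *)
Definition gap_bits (V : seq nat) : seq nat :=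
  sort leq (undup (0 :: pairmap top_bit (head 0 V) (behead V))).

Lemma gap_bits_sorted V : sorted ltn (gap_bits V).
Proof.
by rewrite ltn_sorted_uniq_leq sort_uniq undup_uniq sort_sorted //; apply: leq_total.
Qed.

Lemma size_gap_bits V : size (gap_bits V) <= maxn 1 (size V).
Proof.
rewrite size_sort; apply: leq_trans (size_undup _) _.
by rewrite /= size_pairmap size_behead; lia.
Qed.

(** By [top_bit_trans] the top bit of [y] and [z] is the maximum over the neighboring pairs between
    them, hence equal to one of those. *)
Lemma mem_pairmap_top_bit x s y z : path ltn x s -> y \in x :: s -> z \in x :: s ->
  y < z -> top_bit y z \in pairmap top_bit x s.
Proof.
elim: s x y z => [|x1 s IHs] x y z /=.
  by rewrite !inE => _ /eqP-> /eqP->; rewrite ltnn.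
case/andP=> xx1 ps; rewrite [y \in _]inE [z \in _]inE.
have x1le w : w \in x1 :: s -> x1 <= w.
  rewrite inE => /predU1P[->//|ws]; apply: ltnW.
  by move: ps; rewrite (path_sortedE ltn_trans) => /andP[/allP/(_ _ ws)].
case/predU1P=> [->|ys] /predU1P[->|zs] yz.
- by rewrite ltnn in yz.
- rewrite (@top_bit_trans x x1 z) ?(ltnW xx1) ?x1le //.
  move: zs; rewrite inE => /predU1P[->|zs].
    by rewrite top_bitxx maxn0 mem_head.
  rewrite /maxn; case: ifP => _; last by rewrite mem_head.
  rewrite inE IHs ?mem_head ?orbT // ?inE ?zs ?orbT //.
  by move: ps; rewrite (path_sortedE ltn_trans) => /andP[/allP/(_ _ zs)].
- by have := x1le _ ys; lia.
- by rewrite inE IHs ?orbT.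
Qed.

(** The entry 0 of [gap_bits] serves the case [x = y]. *)
Lemma mem_gap_bits V x y : sorted ltn V -> x \in V -> y \in V ->
  top_bit x y \in gap_bits V.
Proof.
rewrite mem_sort mem_undup inE; case: V => // v V /= pV xV yV.
case: (ltngtP x y) => [xy|yx|->]; last by rewrite top_bitxx.
  by rewrite mem_pairmap_top_bit ?orbT.
by rewrite top_bitC mem_pairmap_top_bit ?orbT.
Qed.

(** A table which, for a level and two ranks in the list of that level, gives the rank of their top
    bit in the list of the next level. With it [skel_seq] imitates the iteration of [step] on ranks,
    without knowing the values. *)
Definition skeleton t m := {ffun 'I_t.+1 * ('I_m.+1 * 'I_m.+1) -> 'I_m.+1}.

Fixpoint skel_seq t m (P : skeleton t m) (u : nat -> nat) (j : nat) : nat -> nat :=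
  if j is j'.+1 then
    fun i => P (inord j', (inord (skel_seq P u j' i), inord (skel_seq P u j' i.+1)))
  else u.

Definition skel_pattern t m k (P : skeleton t m) (u : nat -> nat) :
    {ffun 'I_t * 'I_k -> bool} :=
  [ffun q : 'I_t * 'I_k =>
    (q.2 + q.1 + 1 < k) && (skel_seq P u q.1 q.2 < skel_seq P u q.1 q.2.+1)].

Definition skel_of t m (V : seq nat) : skeleton t m :=
  [ffun q : 'I_t.+1 * ('I_m.+1 * 'I_m.+1) =>
     inord (index (top_bit (nth 0 (iter q.1 gap_bits V) q.2.1)
                           (nth 0 (iter q.1 gap_bits V) q.2.2))
                  (iter q.1.+1 gap_bits V))].

Lemma iter_gap_bits_sorted V j : sorted ltn V -> sorted ltn (iter j gap_bits V).
Proof. by case: j => // j _; apply: gap_bits_sorted. Qed.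

Lemma size_iter_gap_bits m V j : size V = m -> size (iter j gap_bits V) <= m.+1.
Proof.
move=> Vm; elim: j => [|j IHj]; first by rewrite Vm.
by rewrite iterS; apply: leq_trans (size_gap_bits _) _; lia.
Qed.

Lemma skel_seqP t m V u j i : sorted ltn V -> size V = m -> j <= t.+1 ->
  (forall l, l <= j -> u (i + l) < m) ->
  skel_seq (skel_of t m V) u j i < size (iter j gap_bits V) /\
  iter j step (nth 0 V \o u) i =
    nth 0 (iter j gap_bits V) (skel_seq (skel_of t m V) u j i).
Proof.
move=> sV Vm; elim: j i => [|j IHj] i jt um.
  by have := um 0 (leqnn _); rewrite addn0 Vm.
have [lt0 e0] : _ /\ _ := IHj i (ltnW jt) (fun l lj => um l (leqW lj)).
have [|lt1 e1] : _ /\ _ := IHj i.+1 (ltnW jt) _.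
  by move=> l lj; rewrite addSnnS um.
have Vj := size_iter_gap_bits j Vm; have Vj1 := size_iter_gap_bits j.+1 Vm.
set a := skel_seq _ u j i in lt0 e0 *; set b := skel_seq _ u j i.+1 in lt1 e1 *.
set V' := iter j gap_bits V in lt0 e0 lt1 e1 Vj *.
have xV : top_bit (nth 0 V' a) (nth 0 V' b) \in gap_bits V'.
  by rewrite mem_gap_bits ?mem_nth ?iter_gap_bits_sorted.
have -> : skel_seq (skel_of t m V) u j.+1 i =
    index (top_bit (nth 0 V' a) (nth 0 V' b)) (gap_bits V').
  rewrite /= ffunE /= !inordK ?(leq_trans lt0) ?(leq_trans lt1) //.
  by apply: leq_trans Vj1; rewrite index_mem.
by rewrite index_mem nth_index // iterS /step e0 e1.
Qed.

(** The list of each level is strictly increasing, so comparing ranks amounts to comparing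
    values. *)
Lemma skel_patternE t m k V u : sorted ltn V -> size V = m ->
  (forall i, i < k -> u i < m) ->
  pattern t k (nth 0 V \o u) = skel_pattern k (skel_of t m V) u.
Proof.
move=> sV Vm um; apply/ffunP => -[[j jt] [i ik]]; rewrite !ffunE /=.
case: (ltnP (i + j + 1) k) => //= ijk.
have jt1 : j <= t.+1 by exact/leqW/ltnW.
have [|lt0 e0] : _ /\ _ := @skel_seqP t m V u j i sV Vm jt1 _.
  by move=> l lq; apply: um; lia.
have [|lt1 e1] : _ /\ _ := @skel_seqP t m V u j i.+1 sV Vm jt1 _.
  by move=> l lq; apply: um; lia.
rewrite /ascent e0 e1; apply/idP/idP; last first.
  by move=> lt; apply: (sorted_ltn_nth ltn_trans); rewrite ?inE ?iter_gap_bits_sorted.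
apply: contraTT; rewrite -!leqNgt.
by move=> le; apply: (sorted_leq_nth leq_trans leqnn); rewrite ?inE //;
   apply: sub_sorted (iter_gap_bits_sorted _ sV) => a b; apply: ltnW.
Qed.

Lemma card_skeleton t m : #|{: skeleton t m}| = m.+1 ^ (t.+1 * m.+1 ^ 2).
Proof. by rewrite card_ffun !card_prod !card_ord. Qed.

End Skeletons.

(** * Random colorings *)

Lemma expR_le_inv1B (R : realType) (y : R) : y < 1 -> expR y <= (1 - y)^-1.
Proof.
move=> y1; rewrite -[expR y]invrK -expRN lef_pV2 ?posrE ?expR_gt0 ?subr_gt0 //.
exact: expR_ge1Dx.
Qed.

(** The bound [expR y <= 1 / (1 - y)] at [x] and [- x] gives [2 / (1 - x ^+ 2)], which is at most
    [2 * (1 + 2 * x ^+ 2)] in this range. *)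
Lemma cosh_le (R : realType) (x : R) : x ^+ 2 <= 1 / 2 ->
  expR x + expR (- x) <= 2 * expR (2 * x ^+ 2).
Proof.
move=> x2; have x1 : `|x| < 1.
  by rewrite -(@expr_lt1 _ 2) ?normr_ge0 // real_normK ?num_real //; lra.
move: x1; rewrite ltr_norml => /andP[xN1 x1].
have h1 := expR_le_inv1B x1; have h2 : expR (- x) <= (1 + x)^-1.
  by have := @expR_le_inv1B _ (- x); rewrite opprK; apply; lra.
have h3 := expR_ge1Dx (2 * x ^+ 2).
suff : (1 - x)^-1 + (1 + x)^-1 <= 2 * (1 + 2 * x ^+ 2) by lra.
have -> : (1 - x)^-1 + (1 + x)^-1 = 2 / (1 - x ^+ 2).
  by field; apply/and3P; split; rewrite gt_eqF //; nra.
rewrite ler_pdivrMr; last by nra.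
by have := sqr_ge0 x; nra.
Qed.

Lemma sum_fibers (R : realType) (X T : finType) (A : {set X}) (phi : X -> T) (g : T -> R) :
  \sum_s #|[set x in A | phi x == s]|%:R * g s = \sum_(x in A) g (phi x).
Proof.
rewrite (partition_big phi predT) //=; apply: eq_bigr => s _.
rewrite mulr_natl -sumr_const; apply: eq_big => x; rewrite inE //.
by case/andP=> _ /eqP->.
Qed.

(** A Chernoff bound for uniformly random [f], with a union bound over [P] and the two colors. The
    signed sum [S] has independent terms of weights [w], each at most [p * a] and with total [a], so
    that their squares sum to at most [p * a ^+ 2]. *)
Lemma balanced_coloring (R : realType) (Pi X T : finType) (phi : Pi -> X -> T)
    (A : {set X}) (G : pred Pi) (p d : R) :
  0 < p -> 0 < d <= 1 -> (0 < #|A|)%N ->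
  (forall P, G P -> forall s, #|[set x in A | phi P x == s]|%:R <= p * #|A|%:R) ->
  2 * #|Pi|%:R * expR (- (d ^+ 2 / (8 * p))) < 1 ->
  exists f : {ffun T -> bool}, forall P, G P -> forall b,
    2 * #|[set x in A | f (phi P x) == b]|%:R < (1 + d) * #|A|%:R.
Proof.
move=> p0 /andP[d0 d1] A0 atoms small.
set a : R := #|A|%:R; have a0 : 0 < a by rewrite ltr0n.
pose sg (c : bool) : R := if c then 1 else -1.
pose w P s : R := #|[set x in A | phi P x == s]|%:R.
pose S P b (f : {ffun T -> bool}) : R := \sum_s w P s * sg (f s == b).
have SE P b f : S P b f = 2 * #|[set x in A | f (phi P x) == b]|%:R - a.
  rewrite /S /w (sum_fibers A (phi P) (fun s => sg (f s == b))).
  have -> : a = \sum_(x in A) 1 by rewrite sumr_const.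
  have -> : #|[set x in A | f (phi P x) == b]|%:R = \sum_(x in A) (f (phi P x) == b)%:R :> R.
    rewrite -sum1_card natr_sum big_mkcond [RHS]big_mkcond /=; apply: eq_bigr => x _.
    by rewrite !inE; case: (x \in A); case: (_ == b).
  rewrite mulr_sumr -sumrB; apply: eq_bigr => x _.
  by rewrite /sg; case: (_ == b); rewrite ?mulr1 ?mulr0; lra.
(* This choice minimizes the exponent [2 * l ^+ 2 * p * a ^+ 2 - l * d * a]; the minimum is
   [- (d ^+ 2 / (8 * p))]. *)
pose l := d / (4 * p * a).
have l0 : 0 < l by rewrite divr_gt0 // !mulr_gt0.
have moment P b : G P ->
    \sum_f expR (l * S P b f) <= 2 ^+ #|T| * expR (2 * l ^+ 2 * p * a ^+ 2).
  move=> GP; under eq_bigr do rewrite /S mulr_sumr expR_sum.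
  (* Independence: the sum over all [f] of a product over [s] is a product of sums over the two
     values at [s]. *)
  rewrite -(bigA_distr_bigA (fun s c => expR (l * (w P s * sg (c == b))))) /=.
  have w0 s : 0 <= w P s by rewrite ler0n.
  have lw s : (l * w P s) ^+ 2 <= 1 / 2.
    have : l * w P s <= d / 4.
      have -> : d / 4 = l * (p * a) by rewrite /l; field; rewrite !gt_eqF.
      by rewrite ler_pM2l //; apply: atoms.
    have : 0 <= l * w P s by rewrite mulr_ge0 // ltW.
    move: (l * w P s) => z z0 zd; have z1 : z <= 1 / 4 by lra.
    rewrite expr2; nra.
  apply: (@le_trans _ _ (\prod_s (2 * expR (2 * (l * w P s) ^+ 2)))).
    apply: ler_prod => s _; rewrite big_bool /= addr_ge0 ?expR_ge0 //=.
    have := cosh_le (lw s); rewrite /sg.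
    by case: b; rewrite /= !mulr1 !mulrN1 !mulrN // addrC.
  rewrite big_split /= prodr_const ler_pM2l ?exprn_gt0 // -expR_sum ler_expR.
  have -> : 2 * l ^+ 2 * p * a ^+ 2 = \sum_s w P s * (2 * l ^+ 2 * p * a).
    rewrite -mulr_suml (_ : \sum_s w P s = a); first by ring.
    rewrite /a -sum1_card natr_sum -(sum_fibers A (phi P) (fun=> 1)).
    by apply: eq_bigr => s _; rewrite mulr1.
  apply: ler_sum => s _; have -> : 2 * (l * w P s) ^+ 2 = w P s * (2 * l ^+ 2 * w P s) by ring.
  by rewrite ler_wpM2l // -[leRHS]mulrA ler_pM2l ?atoms // mulr_gt0 // exprn_gt0.
apply: contrapT => /forallNP bad.
(* A pair [P], [b] at which [f] fails contributes a term of at least 1. *)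
have {}bad f : 1 <= \sum_(P | G P) \sum_b expR (l * S P b f - l * d * a).
  have /existsNP[P /not_implyP[GP /existsNP[b /negP]]] := bad f.
  rewrite -leNgt => le; rewrite (bigD1 P) //= (bigD1 b) //= -addrA.
  apply: (@le_trans _ _ (expR (l * S P b f - l * d * a))).
    rewrite -[leLHS]expR0 ler_expR SE -mulrA -mulrBr mulr_ge0 ?(ltW l0) //.
    by move: le; rewrite -/a; lra.
  rewrite lerDl addr_ge0 //; first by apply: sumr_ge0 => *; apply: expR_ge0.
  by apply: sumr_ge0 => *; apply: sumr_ge0 => *; apply: expR_ge0.
have : 2 ^+ #|T| <= 2 * #|Pi|%:R * expR (- (d ^+ 2 / (8 * p))) * 2 ^+ #|T| :> R.
  have -> : 2 ^+ #|T| = \sum_(f : {ffun T -> bool}) 1 :> R.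
    by rewrite sumr_const card_ffun card_bool natrX.
  apply: (le_trans (ler_sum _ (fun f _ => bad f))).
  rewrite exchange_big /=; under eq_bigr do rewrite exchange_big /=.
  have -> : \sum_(f : {ffun T -> bool}) 1 = 2 ^+ #|T| :> R.
    by rewrite sumr_const card_ffun card_bool natrX.
  have each P b : G P -> \sum_f expR (l * S P b f - l * d * a) <=
      expR (- (d ^+ 2 / (8 * p))) * 2 ^+ #|T|.
    move=> GP; under eq_bigr do rewrite expRD.
    rewrite -mulr_suml; apply: (le_trans (ler_wpM2r (expR_ge0 _) (moment P b GP))).
    rewrite -[leLHS]mulrA -expRD mulrC ler_pM2r ?exprn_gt0 // ler_expR le_eqVlt; apply/orP; left.
    by apply/eqP; rewrite /l; field; rewrite !gt_eqF.
  apply: (@le_trans _ _ (\sum_(P : Pi | G P) 2 * (expR (- (d ^+ 2 / (8 * p))) * 2 ^+ #|T|))).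
    apply: ler_sum => P GP; rewrite big_bool /= mulr_natl mulr2n.
    by apply: lerD; apply: each.
  set Y := 2 * (_ * _); rewrite big_mkcond /=.
  have -> : 2 * #|Pi|%:R * expR (- (d ^+ 2 / (8 * p))) * 2 ^+ #|T| = \sum_(P : Pi) Y.
    by rewrite sumr_const -[RHS]mulr_natl /Y mulrCA !mulrA.
  apply: ler_sum => P _; rewrite /Y.
  by case: (G P) => //; rewrite !mulr_ge0 ?expR_ge0 // exprn_ge0.
by rewrite -subr_ge0 -[X in _ - X]mul1r -mulrBl pmulr_lge0 ?exprn_gt0 // subr_ge0 leNgt small.
Qed.

(** * Numerical bounds and the main theorem *)

(** The quotient of the binomials is at most [((2 * n - h + 1) / (2 * k)) ^ h]. From [n >= 75]
    follows [25 * (2 * n - h + 1) <= 38 * n], and with [t <= 5 * k / (4 * n)] the base becomes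
    [38 / 50 * 5 / 4 = 19 / 20]. *)
Lemma bin_pow_bound k n h t : (75 <= n)%N -> (4 * n <= k)%N -> h = n./2 ->
  (4 * (n * t) <= 5 * k)%N ->
  ('C(k + n, n - h) * t ^ h * 20 ^ h <= 'C(k + n, n) * 19 ^ h)%N.
Proof.
move=> n75 nk hE nt; have hn : (h <= n)%N by lia.
have ex := bin_ffact_exchange k hn; have am := ffact_AMGM hn.
set C1 := 'C(k + n, n - h) in ex *; set C2 := 'C(k + n, n) in ex *.
have kh : (k ^ h <= (k + h) ^_ h)%N.
  have -> : (k ^ h = \prod_(i < h) k)%N by rewrite prod_nat_const card_ord.
  by rewrite ffact_prod; apply: leq_prod => i _; have := ltn_ord i; lia.
have b1 : (C1 * (k * 2 * 25) ^ h <= C2 * (38 * n) ^ h)%N.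
  apply: (@leq_trans (C2 * ((2 * n - h + 1) * 25) ^ h)); last first.
    rewrite leq_mul2l; apply/orP; right; rewrite leq_exp2r; lia.
  rewrite !expnMn !mulnA leq_mul2r; apply/orP; right.
  apply: (@leq_trans (C2 * n ^_ h * 2 ^ h)); first by rewrite leq_mul2r -ex leq_mul2l kh !orbT.
  by rewrite -mulnA leq_mul2l am orbT.
have n0 : (0 < (10 * n) ^ h)%N by rewrite expn_gt0; lia.
rewrite -(leq_pmul2r n0) -!mulnA -!expnMn.
apply: (@leq_trans (C1 * (k * 2 * 25 * 5) ^ h)).
  rewrite leq_mul2l; apply/orP; right; rewrite leq_exp2r; lia.
have -> : (19 * (10 * n) = 38 * n * 5)%N by lia.
by rewrite !(expnMn _ 5) !mulnA leq_mul2r b1 orbT.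
Qed.

(** * Passing from subsets of M to sets of ranks *)

Section Subsets.
Local Open Scope nat_scope.

Definition ranks_in N (M e : {set 'I_N}) m : {set 'I_m} :=
  [set i : 'I_m | nth 0 (ord_vals M) i \in ord_vals e].

Lemma ord_vals_ranks N (M e : {set 'I_N}) m : #|M| = m -> e \subset M ->
  ord_vals e = [seq nth 0 (ord_vals M) i | i <- ord_vals (ranks_in M e m)].
Proof.
move=> Mm eM; apply: (@irr_sorted_eq _ ltn) => [||||x].
- exact: ltn_trans.
- exact: ltnn.
- exact: ord_vals_sorted.
- apply: (homo_sorted_in (P := gtn m)) (ord_vals_sorted _).
    move=> i j im jm ij; apply: (sorted_ltn_nth ltn_trans) => //.
    - exact: ord_vals_sorted.
    - by rewrite inE size_ord_vals Mm.
    - by rewrite inE size_ord_vals Mm.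
  by apply/allP => i /ord_vals_lt.
apply/idP/mapP => [xe|[i iR ->]]; last first.
  by have im := ord_vals_lt iR; rewrite -[i]/(val (Ordinal im)) mem_ord_vals inE in iR.
have xM : x \in ord_vals M.
  have xN := ord_vals_lt xe; move: xe; rewrite -[x]/(val (Ordinal xN)) !mem_ord_vals.
  exact: (subsetP eM).
have ixm : index x (ord_vals M) < m by rewrite -Mm -size_ord_vals index_mem.
exists (index x (ord_vals M)); last by rewrite nth_index.
by rewrite -[index _ _]/(val (Ordinal ixm)) mem_ord_vals inE nth_index.
Qed.

End Subsets.

(** An edge is colored by a function [f] of its pattern. Edges inside [M] are identified with their
    sets of ranks, whose patterns are computed by the skeleton of [M]; so it suffices that [f] is
    balanced for every skeleton arising from some [M]. *)
Lemma not_almost_mono (R : realType) (k n t N : nat) (p d : R) :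
  (0 < n)%N -> (0 < k)%N -> (N < tw t.+1 2)%N -> 0 < p -> 0 < d <= 1 ->
  'C(k + n, n - n./2)%:R * t.+2%:R ^+ n./2 <= p * 'C(k + n, n)%:R ->
  2 * (k + n).+1%:R ^+ (t.+2 * (k + n).+1 ^ 2) * expR (- (d ^+ 2 / (8 * p))) < 1 ->
  ~~ almost_mono k (k + n) d N.
Proof.
move=> n0 k0 Ntw p0 d01 atom small; set m := (k + n)%N in atom small *.
pose A := [set E : {set 'I_m} | #|E| == k].
have cardA : #|A| = 'C(m, k) by rewrite card_draws card_ord.
have binE : 'C(m, k) = 'C(m, n) by rewrite /m -[in RHS]bin_sub ?leq_addl // addnK.
pose phi (P : skeleton t.+1 m) (E : {set 'I_m}) := skel_pattern k P (elems E).
(* A table that comes from no set may have large fibers; [G] excludes those with too large ones. *)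
pose G := [pred P : skeleton t.+1 m |
  [forall s, #|[set E in A | phi P E == s]|%:R <= p * #|A|%:R]].
have [|P /forallP //||f fP] := @balanced_coloring R _ _ _ phi A G p d p0 d01.
- by rewrite cardA bin_gt0 leq_addr.
- by rewrite card_skeleton natrX.
apply/forallPn; exists [ffun e => f (pattern t.+1 k (elems e))].
apply/existsPn => M; apply/negP => /andP[/eqP Mm /existsP[b]]; apply/negP.
rewrite -ltNge; set V := ord_vals M.
have sV : size V = m by rewrite size_ord_vals.
have pat E : E \in A -> pattern t.+1 k (nth 0%N V \o elems E) = phi (skel_of t.+1 m V) E.
  rewrite inE => /eqP Ek; apply: skel_patternE => //; first exact: ord_vals_sorted.
  by move=> i ik; apply: elems_lt; rewrite Ek.
have GV : G (skel_of t.+1 m V).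
  apply/forallP => s; rewrite cardA binE; apply: le_trans atom.
  rewrite -natrX -natrM ler_nat.
  have -> : [set E in A | phi (skel_of t.+1 m V) E == s] =
      [set E : {set 'I_m} | (#|E| == k) && (pattern t.+1 k (nth 0%N V \o elems E) == s)].
    apply/setP => E; rewrite in_set [in RHS]in_set.
    case: (boolP (E \in A)) => [EA|]; first by rewrite pat //; move: EA; rewrite inE => ->.
    by rewrite inE => /negPf->.
  apply: card_pattern_fiber => // [x xm|x y xy ym].
    apply: ltn_trans Ntw; apply: (@ord_vals_lt _ M).
    by rewrite mem_nth // sV.
  by apply: (sorted_ltn_nth ltn_trans); rewrite ?ord_vals_sorted // inE sV // (ltn_trans xy).
have := fP _ GV b; rewrite cardA => flt.
have le_card : (#|[set e in ksubsets M k | [ffun e => f (pattern t.+1 k (elems e))] e == b]| <=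
    #|[set E in A | f (phi (skel_of t.+1 m V) E) == b]|)%N.
  pose g e := ranks_in M e m.
  have subM e : e \in [set e in ksubsets M k | [ffun e => f (pattern t.+1 k (elems e))] e == b] ->
      [/\ ord_vals e = [seq nth 0%N V i | i <- ord_vals (g e)], #|g e| = k &
          f (pattern t.+1 k (elems e)) = b].
    rewrite !inE ffunE => /andP[/andP[eM /eqP ek] /eqP fe].
    have eE := ord_vals_ranks Mm eM; split=> //.
    by rewrite -ek -!size_ord_vals eE size_map.
  have g_inj : {in [set e in ksubsets M k | [ffun e => f (pattern t.+1 k (elems e))] e == b] &,
      injective g}.
    move=> e e' /subM[eE _ _] /subM[eE' _ _] gg.
    by apply: ord_vals_inj; rewrite eE eE' gg.
  rewrite -(card_in_imset g_inj); apply/subset_leq_card/subsetP => _ /imsetP[e /subM[eE gk fe] ->].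
  have gA : g e \in A by rewrite inE gk.
  rewrite inE gA -pat //= -fe; apply/eqP; congr (f _); apply: eq_pattern => i ik /=.
  by rewrite {2}/elems eE (nth_map m) // size_ord_vals gk.
rewrite mulrAC ltr_pdivlMr // mulrC; apply: le_lt_trans flt.
by rewrite ler_pM2l // ler_nat.
Qed.

Theorem theorem1p1 (R : realType) :
  exists (c : R) (k0 : nat) (eps : R), 0 < c /\ 0 < eps /\
    forall k n : nat, (k0 <= k)%N ->
      c * ln k%:R <= n%:R -> n%:R <= k%:R / 4 :> R ->
      (tw (k %/ n) 2 <= ramsey_almost k (k + n) (2 `^ (- (eps * n%:R))))%N.
Proof.
have ln2_gt0 : 0 < ln 2 :> R by rewrite ln_gt0 // ltr1n.
(* With this [eps], [d = expR (- (n / 320))]. As [p <= expR (- (n / 80))] below,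
   [d ^+ 2 / p >= expR (n / 160)], and [c = 1280] makes this at least [k ^+ 8]. *)
exists 1280, 4%N, (320 * ln 2)^-1; split=> //; split; first by rewrite invr_gt0 mulr_gt0.
move=> k n k4 cn nk4.
have k0 : 0 < k%:R :> R by rewrite ltr0n; lia.
have lnk : 1 / 2 <= ln k%:R :> R.
  rewrite -ler_expR lnK ?posrE //; apply: (@le_trans _ _ (1 - 1 / 2)^-1).
    by apply: expR_le_inv1B; lra.
  have -> : (1 - 1 / 2)^-1 = 2 :> R by field.
  by rewrite ler_nat; lia.
have n640 : (640 <= n)%N by rewrite -(ler_nat R); lra.
have nk : (4 * n <= k)%N by rewrite -(ler_nat R) natrM; lra.
set d := _ `^ _; set N := ramsey_almost _ _ _.
have dE : d = expR (- (n%:R / 320)).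
  rewrite /d /powR; case: eqP => [/eqP|_]; first by rewrite pnatr_eq0.
  by congr expR; field; rewrite gt_eqF.
have d01 : 0 < d <= 1.
  by rewrite dE expR_gt0 -[X in _ <= X]expR0 ler_expR oppr_le0 divr_ge0.
have /andP[_ d1] := d01; have [alm _] := ramsey_almostP k (k + n) d1.
rewrite leqNgt; apply/negP => Ntw; apply/negP: alm.
have kn4 : (4 <= k %/ n)%N by rewrite leq_divRL ?(leq_trans _ n640).
case tE : (k %/ n)%N kn4 Ntw => [//|t] t4 Ntw.
have tn : (n * t.+1 <= k)%N by rewrite -tE mulnC leq_trunc_div.
have n_gt0 : (0 < n)%N by apply: leq_trans n640.
have k_gt0 : (0 < k)%N by apply: leq_trans k4.
have tk : (t.+1 <= k)%N by apply: leq_trans tn; rewrite leq_pmull.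
(* Here [n * t.+1 <= k], and the additional [n] is at most [k / 4]. *)
have tn5 : (4 * (n * t.+2) <= 5 * k)%N.
  by rewrite mulnS; move: (n * t.+1)%N tn nk; clear; lia.
have [h hE] : {h | h = n./2} by exists n./2.
have n75 : (75 <= n)%N by apply: leq_trans n640.
have nh : (n <= 4 * h)%N by move: hE n640; clear; lia.
pose p : R := (19 / 20) ^+ h.
have p0 : 0 < p by rewrite exprn_gt0 // divr_gt0.
apply: (@not_almost_mono _ _ _ t _ p) => //.
  rewrite -hE.
  have := @bin_pow_bound k n h t.+2 n75 nk hE tn5.
  rewrite -(ler_nat R) !natrM !natrX => le.
  by rewrite /p expr_div_n mulrAC ler_pdivlMr ?exprn_gt0 // [leRHS]mulrC.
have pexp : p <= expR (- (n%:R / 80)).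
  have e19 : (19 / 20 : R) <= expR (- (1 / 20)).
    by apply: le_trans (expR_ge1Dx _); lra.
  apply: (@le_trans _ _ (expR (- (1 / 20)) ^+ h)); first by rewrite lerXn2r ?nnegrE ?expR_ge0 //; lra.
  rewrite -expRM_natl ler_expR.
  have : n%:R <= 4 * h%:R :> R by rewrite -natrM ler_nat.
  lra.
have k8 : k%:R ^+ 8 / 8 <= d ^+ 2 / (8 * p).
  rewrite ler_pdivlMr ?mulr_gt0 // mulrA divfK ?pnatr_eq0 // dE -expRM_natl.
  have -> : k%:R ^+ 8 = expR (8 * ln k%:R) :> R by rewrite expRM_natl lnK.
  apply: (le_trans (ler_wpM2l (expR_ge0 _) pexp)).
  by rewrite -expRD ler_expR; lra.
set m := (k + n).+1; set e := (t.+2 * m ^ 2)%N.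
have mexp : m%:R <= expR m%:R :> R by apply: le_trans (expR_ge1Dx _); rewrite lerDr.
have two : 2 <= expR 1 :> R by apply: le_trans (expR_ge1Dx _).
(* There are [m ^ e <= expR (m * e)] skeletons. Their logarithm is thus at most [16 * k ^ 4], which
   [k ^ 8 / 8] outweighs for [k >= 4]. *)
have me : (m * e <= 16 * k ^ 4)%N.
  apply: (@leq_trans ((2 * k) * (2 * k * (2 * k) ^ 2))); last by rewrite !expnS; clear; lia.
  have m2k : (m <= 2 * k)%N by rewrite /m; move: nk n640; clear; lia.
  have t2k : (t.+2 <= 2 * k)%N by move: tk k4; clear; lia.
  by rewrite leq_mul // leq_mul // leq_exp2r.
apply: (@le_lt_trans _ _ (expR (1 + m%:R * e%:R - k%:R ^+ 8 / 8))).
  rewrite !expRD; apply: ler_pM; rewrite ?expR_ge0 ?mulr_ge0 ?exprn_ge0 //.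
    by rewrite expRM_natr ler_pM ?exprn_ge0 // lerXn2r ?nnegrE ?expR_ge0.
  by rewrite ler_expR lerN2.
rewrite -[X in _ < X]expR0 ltr_expR.
have : m%:R * e%:R <= 16 * k%:R ^+ 4 :> R by rewrite -natrX -!natrM ler_nat.
have : 256 <= k%:R ^+ 4 :> R by rewrite -natrX ler_nat (@leq_exp2r 4 k 4).
have -> : k%:R ^+ 8 = (k%:R ^+ 4) ^+ 2 :> R by rewrite -exprM.
by move: (k%:R ^+ 4 : R) (m%:R * e%:R : R) => x y; nra.
Qed.
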